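(* Let $(G,M,N)$ be a triple of groups and let $\mathcal{V}$ be an arbitrary variety of groups defined by a set of laws $V$. Then $\mathcal{V}M(G,M,N)$ fits into the following long exact sequences (the dots denoting a continuation to the left): $$\begin{array}{ll}\cdots &\rightarrow\mathcal{V}M(G,M,N)\rightarrow\mathcal{V}M(G,N)\rightarrow\mathcal{V}M(G/M,MN/M)\\ &\rightarrow\pi_0(\ker(\alpha_V,\gamma_V))\rightarrow N/[NV^*G]\rightarrow MN/M[NV^*G]\rightarrow 0\end{array}$$ and $$\begin{array}{ll}\cdots &\rightarrow\mathcal{V}M(G,M,N)\rightarrow\mathcal{V}M(G,M)\rightarrow\mathcal{V}M(G/N,MN/N)\\ &\rightarrow\pi_0(\ker(\alpha_V,\gamma_V))\rightarrow M/[MV^*G]\rightarrow MN/N[MV^*G]\rightarrow 0.\end{array}$$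
   Context: A triple of groups $(G,M,N)$ is a group $G$ with two normal subgroups $M,N$; a pair $(G,N)$ is a group with a normal subgroup. $V(G)$ is the verbal subgroup of $G$ for the laws $V$; for a simplicial group $K_.$, $V(K_.)$ is formed degreewise. For a normal subgroup $N$ of $G$, $[NV^*G]$ denotes the subgroup of $G$ generated by all elements $v(g_1,\dots,g_in,\dots,g_r)\,v(g_1,\dots,g_r)^{-1}$ with $v\in V$ (a word in $r$ variables), $1\le i\le r$, $g_1,\dots,g_r\in G$, $n\in N$. A simplicial group $K_.$ is free if each $K_n$ is a free group with a basis such that all degeneracies send the basis of $K_n$ into the basis of $K_{n+1}$. A free simplicial resolution of $G$ is a free simplicial group $K_.$ with $\pi_0(K_.)=G$ and $\pi_n(K_.)=0$ for $n\ge1$. Baer invariant of a pair $(G,N)$: $\mathcal{V}M(G,N):=\pi_1(\ker\alpha_V)$, where $\alpha:K_.\to L_.$ is a surjective simplicial homomorphism of free simplicial resolutions of $G$ and $G/N$ inducing the projection $G\to G/N$ on $\pi_0$, and $\alpha_V:K_./V(K_.)\to L_./V(L_.)$ is the induced map. Baer invariant of a triple $(G,M,N)$: take free simplicial resolutions $K_.,L_.,R_.,S_.$ of $G$, $G/N$, $G/M$, $G/MN$, respectively, and a commutative square of simplicial homomorphisms $\alpha:K_.\to L_.$, $\beta:K_.\to R_.$, $\gamma:R_.\to S_.$, $\delta:L_.\to S_.$ (with $\gamma\beta=\delta\alpha$) inducing the natural projections on $\pi_0$, such that the induced maps $\alpha_V,\beta_V,\gamma_V,\delta_V$ between the quotients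 $K_./V(K_.)$, $L_./V(L_.)$, $R_./V(R_.)$, $S_./V(S_.)$ are surjective, and the induced maps $\ker\alpha_V\to\ker\gamma_V$ and $\ker\beta_V\to\ker\delta_V$ are surjective (so one has a $3\times3$ commutative diagram with short exact rows and columns). Let $\ker(\alpha_V,\gamma_V)$ denote the kernel of $\ker\alpha_V\to\ker\gamma_V$ (equivalently of $\ker\beta_V\to\ker\delta_V$). Then $\mathcal{V}M(G,M,N):=\pi_1(\ker(\alpha_V,\gamma_V))$. *)

(* Defs.v *)
From HB Require Import structures.
From mathcomp Require Import all_boot.
From mathcomp Require Import boolp.

Set Implicit Arguments.
Unset Strict Implicit.
Unset Printing Implicit Defensive.

Local Open Scope group_scope.
Local Open Scope quotient_scope.

(******************************************************************************)
(* Groups are arbitrary, possibly infinite, groupTypes; homomorphisms are     *)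
(* {multiplicative G -> H}; subgroups are boolean predicates, which is no     *)
(* restriction in the presence of boolp.                                      *)
(*         sect H N == H / N for N <= H <= G with N normal in G, formed as    *)
(*                     H / (H :&: N)                                          *)
(*       verbal V G == the verbal subgroup V(G)                               *)
(*       nvstar V N == [N V* G]                                               *)
(*        prodn M N == MN                                                     *)
(******************************************************************************)

Section Homs.
Variables G H : groupType.

Definition mkhom (f : G -> H) (fM : {morph f : x y / x * y}) :
    {multiplicative G -> H} :=
  HB.pack_for {multiplicative G -> H} f (isMultiplicative.Build G H f fM).

Lemma homM (f : {multiplicative G -> H}) x y : f (x * y) = f x * f y.
Proof. exact: gmulfM. Qed.

Lemma hom1 (f : {multiplicative G -> H}) : f 1 = 1.
Proof. by apply: (mulgI (f 1)); rewrite -homM !mulg1. Qed.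

Lemma homV (f : {multiplicative G -> H}) x : f x^-1 = (f x)^-1.
Proof. by apply: (mulgI (f x)); rewrite -homM !mulgV hom1. Qed.

Lemma homJ (f : {multiplicative G -> H}) x y : f (x ^ y) = f x ^ f y.
Proof. by rewrite !homM homV. Qed.

End Homs.

Definition surj (A B : Type) (f : A -> B) : Prop := forall y, exists x, f x = y.

Definition exact (A B C : groupType) (f : {multiplicative A -> B})
  (g : {multiplicative B -> C}) : Prop :=
  forall y : B, g y = 1 <-> exists x : A, f x = y.

HB.mixin Record isConjClosed (G : groupType) (S : {pred G}) := {
  gpredJg : forall x y, x \in S -> x ^ y \in S
}.

#[short(type="normalClosed")]
HB.structure Definition NormalClosed (G : groupType) :=
  {S of isConjClosed G S & GroupClosed G S}.

Section Sub.
Variables (G : groupType) (H : groupClosed G).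

Definition subg : Type := {x : G | x \in H}.

HB.instance Definition _ := [isSub of subg for @sval G (fun x => x \in H)].
HB.instance Definition _ := [Choice of subg by <:].

Lemma subg_closed : group_closed (fun x : G => x \in H).
Proof. by split=> [|x y xH yH]; [exact: gpred1 | exact: gpredF]. Qed.

HB.instance Definition _ :=
  SubChoice_isSubGroup.Build G (fun x => x \in H) subg subg_closed.

Definition subg_val : {multiplicative subg -> G} :=
  mkhom (fun x y : subg => erefl (val (x * y))).

Definition mksubg (x : G) (xH : x \in H) : subg := exist _ x xH.

End Sub.

Section SubMap.
Variables (G G' : groupType) (H : groupClosed G) (H' : groupClosed G').
Variables (f : {multiplicative G -> G'}) (fH : forall x, x \in H -> f x \in H').

Definition subg_map_fun (x : subg H) : subg H' := mksubg (fH (valP x)).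

Fact subg_map_morph : {morph subg_map_fun : x y / x * y}.
Proof. by move=> x y; apply: val_inj; rewrite /= homM. Qed.

Definition subg_map : {multiplicative subg H -> subg H'} := mkhom subg_map_morph.

End SubMap.

Section Quotient.
Variables (G : groupType) (N : normalClosed G).

Definition quot_rel : rel G := fun x y => x^-1 * y \in N.

Fact quot_rel_refl : reflexive quot_rel.
Proof. by move=> x; rewrite /quot_rel mulVg gpred1. Qed.

Fact quot_rel_sym : symmetric quot_rel.
Proof. by move=> x y; rewrite /quot_rel -(gpredV N (x^-1 * y)) invgM invgK. Qed.

Fact quot_rel_trans : transitive quot_rel.
Proof.
move=> y x z xy yz; rewrite /quot_rel.
have -> : x^-1 * z = x^-1 * y * (y^-1 * z) by rewrite -mulgA mulVKg.
exact: gpredM.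
Qed.

Canonical quot_equiv := EquivRel quot_rel quot_rel_refl quot_rel_sym quot_rel_trans.

Definition quot : Type := {eq_quot quot_equiv}.

HB.instance Definition _ := Choice.on quot.
HB.instance Definition _ : EqQuotient _ quot_equiv quot := EqQuotient.on quot.

Definition proj_fun (x : G) : quot := \pi_quot x.

Lemma proj_eq (x y : G) : proj_fun x = proj_fun y <-> x^-1 * y \in N.
Proof. by split=> [/eqmodP|xy]; [|apply/eqmodP]. Qed.

Lemma proj_surj : surj proj_fun.
Proof. by move=> y; exists (repr y); exact: reprK. Qed.

Definition quot_mul (x y : quot) : quot := proj_fun (repr x * repr y).
Definition quot_inv (x : quot) : quot := proj_fun (repr x)^-1.

Lemma quot_mulE x y : quot_mul (proj_fun x) (proj_fun y) = proj_fun (x * y).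
Proof.
have /proj_eq hx : proj_fun (repr (proj_fun x)) = proj_fun x by exact: reprK.
have /proj_eq hy : proj_fun (repr (proj_fun y)) = proj_fun y by exact: reprK.
apply/proj_eq; set a := repr _ in hx *; set b := repr _ in hy *.
have -> : (a * b)^-1 * (x * y) = (a^-1 * x) ^ b * (b^-1 * y).
  by rewrite /conjg invgM !mulgA mulgK.
by rewrite gpredM// gpredJg.
Qed.

Lemma quot_invE x : quot_inv (proj_fun x) = proj_fun x^-1.
Proof.
have /proj_eq hx : proj_fun (repr (proj_fun x)) = proj_fun x by exact: reprK.
apply/proj_eq; set a := repr _ in hx *; rewrite invgK.
have -> : a * x^-1 = ((a^-1 * x) ^ a^-1)^-1.
  by rewrite /conjg invgK -mulgA mulVKg invgF.
by rewrite gpredV gpredJg.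
Qed.

Fact quot_mulA : associative quot_mul.
Proof.
move=> x y z; have [[[a <-] [b <-]] [c <-]] := (proj_surj x, proj_surj y, proj_surj z).
by rewrite !quot_mulE mulgA.
Qed.

Fact quot_mul1 : left_id (proj_fun 1) quot_mul.
Proof. by move=> x; have [a <-] := proj_surj x; rewrite quot_mulE mul1g. Qed.

Fact quot_1mul : right_id (proj_fun 1) quot_mul.
Proof. by move=> x; have [a <-] := proj_surj x; rewrite quot_mulE mulg1. Qed.

Fact quot_mulV : left_inverse (proj_fun 1) quot_inv quot_mul.
Proof.
by move=> x; have [a <-] := proj_surj x; rewrite quot_invE quot_mulE mulVg.
Qed.

Fact quot_Vmul : right_inverse (proj_fun 1) quot_inv quot_mul.
Proof.
by move=> x; have [a <-] := proj_surj x; rewrite quot_invE quot_mulE mulgV.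
Qed.

HB.instance Definition _ :=
  isGroup.Build quot quot_mulA quot_mul1 quot_1mul quot_mulV quot_Vmul.

Fact proj_morph : {morph proj_fun : x y / x * y}.
Proof. by move=> x y; rewrite -quot_mulE. Qed.

Definition proj : {multiplicative G -> quot} := mkhom proj_morph.

End Quotient.

Section QuotMap.
Variables (G G' : groupType) (N : normalClosed G) (N' : normalClosed G').
Variables (f : {multiplicative G -> G'}) (fN : forall x, x \in N -> f x \in N').

Definition quot_map_fun (x : quot N) : quot N' := proj N' (f (repr x)).

Lemma quot_map_funE x : quot_map_fun (proj N x) = proj N' (f x).
Proof.
have /proj_eq hx : proj N (repr (proj N x)) = proj N x by exact: reprK.
by apply/proj_eq; rewrite -homV -homM fN.
Qed.

Fact quot_map_morph : {morph quot_map_fun : x y / x * y}.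
Proof.
move=> x y; have [[a <-] [b <-]] := (proj_surj x, proj_surj y).
rewrite -[proj_fun N a]/(proj N a) -[proj_fun N b]/(proj N b) -homM.
by rewrite !quot_map_funE !homM.
Qed.

Definition quot_map : {multiplicative quot N -> quot N'} := mkhom quot_map_morph.

Lemma quot_mapE x : quot_map (proj N x) = proj N' (f x).
Proof. exact: quot_map_funE. Qed.

End QuotMap.

Section Preimage.
Variables (G H : groupType) (f : {multiplicative G -> H}) (N : normalClosed H).

Definition preim : {pred G} := fun x => f x \in N.

Lemma preimE x : (x \in preim) = (f x \in N).
Proof. by []. Qed.

Fact preimM : mulg_closed preim.
Proof. by move=> x y; rewrite !preimE homM; exact: gpredM. Qed.
Fact preim1 : 1 \in preim.
Proof. by rewrite preimE hom1 gpred1. Qed.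
Fact preimV : invg_closed preim.
Proof. by move=> x; rewrite !preimE homV gpredV. Qed.
Fact preimJ x y : x \in preim -> x ^ y \in preim.
Proof. by rewrite !preimE homJ; exact: gpredJg. Qed.

HB.instance Definition _ := isMulClosed.Build G preim preimM.
HB.instance Definition _ := isMul1Closed.Build G preim preim1.
HB.instance Definition _ := isInvClosed.Build G preim preimV.
HB.instance Definition _ := isConjClosed.Build G preim preimJ.

Definition kerg : {pred G} := fun x => f x == 1.

Lemma kergE x : (x \in kerg) = (f x == 1).
Proof. by []. Qed.

Fact kergM : mulg_closed kerg.
Proof. by move=> x y; rewrite !kergE homM => /eqP-> /eqP->; rewrite mulg1. Qed.
Fact kerg1 : 1 \in kerg.
Proof. by rewrite kergE hom1. Qed.
Fact kergV : invg_closed kerg.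
Proof. by move=> x; rewrite !kergE homV => /eqP->; rewrite invg1. Qed.
Fact kergJ x y : x \in kerg -> x ^ y \in kerg.
Proof. by rewrite !kergE homJ => /eqP->; rewrite conj1g. Qed.

HB.instance Definition _ := isMulClosed.Build G kerg kergM.
HB.instance Definition _ := isMul1Closed.Build G kerg kerg1.
HB.instance Definition _ := isInvClosed.Build G kerg kergV.
HB.instance Definition _ := isConjClosed.Build G kerg kergJ.

End Preimage.

Definition sect (G : groupType) (H : groupClosed G) (N : normalClosed G) :
    groupType := quot (preim (subg_val H) N).

Section SectMap.
Variables (G G' : groupType) (H : groupClosed G) (H' : groupClosed G').
Variables (N : normalClosed G) (N' : normalClosed G').
Variables (f : {multiplicative G -> G'}).
Hypothesis fH : forall x, x \in H -> f x \in H'.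
Hypothesis fN : forall x, x \in N -> f x \in N'.

Fact sect_map_sub (x : subg H) :
  x \in preim (subg_val H) N -> subg_map fH x \in preim (subg_val H') N'.
Proof. by rewrite !preimE; exact: fN. Qed.

Definition sect_map : {multiplicative sect H N -> sect H' N'} :=
  quot_map sect_map_sub.

End SectMap.

Definition idhom (G : groupType) : {multiplicative G -> G} := @idfun G.

Section QuotProj.
Variables (G : groupType) (N N' : normalClosed G).
Hypothesis sNN' : forall x, x \in N -> x \in N'.

Definition quot_proj : {multiplicative quot N -> quot N'} :=
  @quot_map G G N N' (idhom G) sNN'.

End QuotProj.

Section Product.
Variables (G : groupType) (M N : normalClosed G).

Definition prodn : {pred G} :=
  fun x => `[< exists m n, [/\ m \in M, n \in N & x = m * n] >].

Lemma prodnP x :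
  reflect (exists m n, [/\ m \in M, n \in N & x = m * n]) (x \in prodn).
Proof. exact: asboolP. Qed.

Fact prodnM : mulg_closed prodn.
Proof.
move=> _ _ /prodnP[m [n [mM nN ->]]] /prodnP[m' [n' [mM' nN' ->]]].
apply/prodnP; exists (m * m'), (n ^ m' * n').
split; [exact: gpredM|by rewrite gpredM ?gpredJg|].
by rewrite -[RHS]mulgA [m' * (_ * _)]mulgA -conjgC -!mulgA.
Qed.
Fact prodn1 : 1 \in prodn.
Proof. by apply/prodnP; exists 1, 1; rewrite !gpred1 mulg1. Qed.
Fact prodnV : invg_closed prodn.
Proof.
move=> _ /prodnP[m [n [mM nN ->]]]; apply/prodnP.
exists m^-1, (n^-1 ^ m^-1); split; rewrite ?gpredJg ?gpredV//.
by rewrite /conjg invgK invgM mulKg.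
Qed.
Fact prodnJ x y : x \in prodn -> x ^ y \in prodn.
Proof.
case/prodnP=> m [n [mM nN ->]]; apply/prodnP; exists (m ^ y), (n ^ y).
by split; rewrite ?gpredJg// conjMg.
Qed.

HB.instance Definition _ := isMulClosed.Build G prodn prodnM.
HB.instance Definition _ := isMul1Closed.Build G prodn prodn1.
HB.instance Definition _ := isInvClosed.Build G prodn prodnV.
HB.instance Definition _ := isConjClosed.Build G prodn prodnJ.

Lemma prodn_subl x : x \in M -> x \in prodn.
Proof. by move=> xM; apply/prodnP; exists x, 1; rewrite gpred1 mulg1. Qed.

Lemma prodn_subr x : x \in N -> x \in prodn.
Proof. by move=> xN; apply/prodnP; exists 1, x; rewrite gpred1 mul1g. Qed.

End Product.

Section Generated.
Variable G : groupType.
Implicit Types (A : G -> Prop) (H : groupClosed G).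

Definition gen A : {pred G} :=
  fun x => `[< forall H, (forall a, A a -> a \in H) -> x \in H >].

Lemma genP A x :
  reflect (forall H, (forall a, A a -> a \in H) -> x \in H) (x \in gen A).
Proof. exact: asboolP. Qed.

Fact genM A : mulg_closed (gen A).
Proof.
by move=> x y /genP xA /genP yA; apply/genP=> H AH; rewrite gpredM ?xA ?yA.
Qed.
Fact gen1 A : 1 \in gen A.
Proof. by apply/genP=> H _; exact: gpred1. Qed.
Fact genV A : invg_closed (gen A).
Proof. by move=> x /genP xA; apply/genP=> H AH; rewrite gpredV xA. Qed.

HB.instance Definition _ A := isMulClosed.Build G (gen A) (genM (A:=A)).
HB.instance Definition _ A := isMul1Closed.Build G (gen A) (gen1 A).
HB.instance Definition _ A := isInvClosed.Build G (gen A) (genV (A:=A)).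

Lemma gen_mem A a : A a -> a \in gen A.
Proof. by move=> Aa; apply/genP=> H; apply. Qed.

End Generated.

Section PreimageSub.
Variables (G H : groupType) (f : {multiplicative G -> H}) (K : groupClosed H).

Definition preims : {pred G} := fun x => f x \in K.

Lemma preimsE x : (x \in preims) = (f x \in K).
Proof. by []. Qed.

Fact preimsM : mulg_closed preims.
Proof. by move=> x y; rewrite !preimsE homM; exact: gpredM. Qed.
Fact preims1 : 1 \in preims.
Proof. by rewrite preimsE hom1 gpred1. Qed.
Fact preimsV : invg_closed preims.
Proof. by move=> x; rewrite !preimsE homV gpredV. Qed.

HB.instance Definition _ := isMulClosed.Build G preims preimsM.
HB.instance Definition _ := isMul1Closed.Build G preims preims1.
HB.instance Definition _ := isInvClosed.Build G preims preimsV.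

End PreimageSub.

Lemma gen_hom (G H : groupType) (f : {multiplicative G -> H}) A B x :
  (forall a, A a -> B (f a)) -> x \in gen A -> f x \in gen B.
Proof.
move=> AB /genP xA; rewrite -preimsE; apply: xA => a /AB.
by rewrite preimsE; exact: gen_mem.
Qed.

Definition conjhom (G : groupType) (y : G) : {multiplicative G -> G} :=
  mkhom (fun x x' => conjMg x x' y).

(* A word in r variables is a word in the letters x_i (encoded (i, false))    *)
(* and x_i^-1 (encoded (i, true)), i < r.                                     *)
Definition word (r : nat) : Type := seq ('I_r * bool).

Definition laws : Type := forall r, word r -> Prop.

Definition eval (G : groupType) r (v : word r) (g : 'I_r -> G) : G :=
  \prod_(a <- v) (if a.2 then (g a.1)^-1 else g a.1).

Lemma eval_hom (G H : groupType) (f : {multiplicative G -> H}) r (v : word r) g :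
  f (eval v g) = eval v (f \o g).
Proof.
rewrite /eval; elim: v => [|[i b] v IHv]; first by rewrite !big_nil hom1.
by rewrite !big_cons homM IHv; case: b => //=; rewrite homV.
Qed.

Lemma eq_eval (G : groupType) r (v : word r) (g h : 'I_r -> G) :
  g =1 h -> eval v g = eval v h.
Proof. by move=> gh; apply: eq_bigr => a _; rewrite gh. Qed.

Section Verbal.
Variables (V : laws) (G : groupType).

Definition verbal_gen (x : G) : Prop :=
  exists r (v : word r) (g : 'I_r -> G), V v /\ x = eval v g.

Definition verbal : {pred G} := gen verbal_gen.

HB.instance Definition _ := GroupClosed.on verbal.

End Verbal.

Arguments verbal V G : clear implicits.

Section VerbalMap.
Variables (V : laws) (G H : groupType) (f : {multiplicative G -> H}).

Lemma verbal_hom x : x \in verbal V G -> f x \in verbal V H.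
Proof.
apply: gen_hom => _ [r [v [g [Vv ->]]]]; exists r, v, (f \o g).
by rewrite eval_hom.
Qed.

End VerbalMap.

Fact verbalJ V G x y : x \in verbal V G -> x ^ y \in verbal V G.
Proof. exact: (verbal_hom (conjhom y)). Qed.

HB.instance Definition _ V G := isConjClosed.Build G (verbal V G) (@verbalJ V G).

Section NVstar.
Variables (V : laws) (G : groupType) (N : normalClosed G).

Definition nvstar_gen (x : G) : Prop :=
  exists r (v : word r) (i : 'I_r) (g : 'I_r -> G) (n : G), [/\ V v, n \in N &
    x = eval v (fun j => if j == i then g j * n else g j) * (eval v g)^-1].

Definition nvstar : {pred G} := gen nvstar_gen.

HB.instance Definition _ := GroupClosed.on nvstar.

Fact nvstarJ x y : x \in nvstar -> x ^ y \in nvstar.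
Proof.
apply: (@gen_hom _ _ (conjhom y)) => _ [r [v [i [g [n [Vv nN ->]]]]]].
exists r, v, i, (conjhom y \o g), (n ^ y); split; rewrite ?gpredJg//.
rewrite homM homV !eval_hom; congr (_ * _); apply: eq_eval => j /=.
by case: ifP => // _; exact: conjMg.
Qed.

HB.instance Definition _ := isConjClosed.Build G nvstar nvstarJ.

End NVstar.

Definition free_basis (G : groupType) (X : G -> Prop) : Prop :=
  forall (H : groupType) (f : G -> H),
    exists2 phi : {multiplicative G -> H}, (forall x, X x -> phi x = f x) &
      forall psi : {multiplicative G -> H},
        (forall x, X x -> psi x = f x) -> psi =1 phi.

(* Simplicial groups. In the simplicial identities, upr i and suc i are the   *)
(* indices i and i + 1 in the next larger ordinal type.                       *)
Definition upr n (i : 'I_n) : 'I_n.+1 := widen_ord (leqnSn n) i.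
Definition suc n (i : 'I_n) : 'I_n.+1 := lift ord0 i.

Record sgroup := SGroup {
  sobj :> nat -> groupType;
  face : forall n, 'I_n.+2 -> {multiplicative sobj n.+1 -> sobj n};
  degen : forall n, 'I_n.+1 -> {multiplicative sobj n -> sobj n.+1};
  face_face : forall n (i j : 'I_n.+2) x, (i <= j)%N ->
    face i (face (suc j) x) = face j (face (upr i) x);
  face_degen_lt : forall n (i : 'I_n.+2) (j : 'I_n.+1) x, (i <= j)%N ->
    face (upr i) (degen (suc j) x) = degen j (face i x);
  face_degen_eq : forall n (j : 'I_n.+1) (x : sobj n),
    face (upr j) (degen j x) = x;
  face_degen_eqS : forall n (j : 'I_n.+1) (x : sobj n),
    face (suc j) (degen j x) = x;
  face_degen_gt : forall n (i : 'I_n.+2) (j : 'I_n.+1) x, (j < i)%N ->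
    face (suc i) (degen (upr j) x) = degen j (face i x);
  degen_degen : forall n (i j : 'I_n.+1) (x : sobj n), (i <= j)%N ->
    degen (upr i) (degen j x) = degen (suc j) (degen i x)
}.

Arguments face {s n} i : rename.
Arguments degen {s n} i : rename.

Record shom (K L : sgroup) := SHom {
  smap :> forall n, {multiplicative K n -> L n};
  smap_face : forall n (i : 'I_n.+2) x, smap n (face i x) = face i (smap n.+1 x);
  smap_degen : forall n (i : 'I_n.+1) x,
    smap n.+1 (degen i x) = degen i (smap n x)
}.

Definition ssurj (K L : sgroup) (f : shom K L) : Prop := forall n, surj (f n).

Section Comp.
Variables (K L M : sgroup) (g : shom L M) (f : shom K L).

Definition scomp_fun n : {multiplicative K n -> M n} := g n \o f n.

Definition scomp : shom K M.
Proof.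
by exists scomp_fun => n i x; rewrite /= ?smap_face ?smap_degen.
Defined.

End Comp.

Section Kernel.
Variables (K L : sgroup) (f : shom K L).

Fact sker_face_sub n (i : 'I_n.+2) x :
  x \in kerg (f n.+1) -> face i x \in kerg (f n).
Proof. by rewrite !kergE smap_face => /eqP->; rewrite hom1. Qed.

Fact sker_degen_sub n (i : 'I_n.+1) x :
  x \in kerg (f n) -> degen i x \in kerg (f n.+1).
Proof. by rewrite !kergE smap_degen => /eqP->; rewrite hom1. Qed.

Definition sker : sgroup.
Proof.
apply: (@SGroup (fun n => subg (kerg (f n)))
  (fun n i => subg_map (@sker_face_sub n i))
  (fun n i => subg_map (@sker_degen_sub n i))) => *; apply: val_inj => /=.
- exact: face_face.
- exact: face_degen_lt.
- exact: face_degen_eq.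
- exact: face_degen_eqS.
- exact: face_degen_gt.
- exact: degen_degen.
Defined.

Definition sker_incl : shom sker K.
Proof. by exists (fun n => subg_val (kerg (f n))). Defined.

End Kernel.

(* corestriction of g : M -> K to the kernel of f : K -> L *)
Section KernelLift.
Variables (M K L : sgroup) (f : shom K L) (g : shom M K).
Hypothesis fg1 : forall n x, f n (g n x) = 1.

Fact sker_lift_in n x : g n x \in kerg (f n).
Proof. by rewrite kergE fg1. Qed.

Definition sker_lift_fun n (x : M n) : subg (kerg (f n)) :=
  mksubg (sker_lift_in x).

Fact sker_lift_morph n : {morph @sker_lift_fun n : x y / x * y}.
Proof. by move=> x y; apply: val_inj; rewrite /= homM. Qed.

Definition sker_lift : shom M (sker f).
Proof.
exists (fun n => mkhom (@sker_lift_morph n)) => n i x; apply: val_inj => /=.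
- exact: smap_face.
- exact: smap_degen.
Defined.

End KernelLift.

Section VQuotient.
Variable V : laws.

Section Vmap.
Variables G H : groupType.

Definition vmap (f : {multiplicative G -> H}) :
    {multiplicative quot (verbal V G) -> quot (verbal V H)} :=
  quot_map (verbal_hom f).

Lemma vmapE f x : vmap f (proj _ x) = proj _ (f x).
Proof. exact: quot_mapE. Qed.

Lemma quot_ind (N : normalClosed G) (P : quot N -> Prop) :
  (forall x, P (proj N x)) -> forall x, P x.
Proof. by move=> h x; have [a <-] := proj_surj x; exact: h. Qed.

End Vmap.

Lemma vmap_id2 (G H : groupType) (f : {multiplicative G -> H})
    (g : {multiplicative H -> G}) :
  (forall x, g (f x) = x) -> forall x, vmap g (vmap f x) = x.
Proof. by move=> h; elim/quot_ind=> x; rewrite !vmapE h. Qed.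

Lemma vmap_eq2 (G H H' K : groupType)
    (f : {multiplicative G -> H}) (g : {multiplicative H -> K})
    (f' : {multiplicative G -> H'}) (g' : {multiplicative H' -> K}) :
  (forall x, g (f x) = g' (f' x)) ->
  forall x, vmap g (vmap f x) = vmap g' (vmap f' x).
Proof. by move=> h; elim/quot_ind=> x; rewrite !vmapE h. Qed.

Definition squot (K : sgroup) : sgroup.
Proof.
apply: (@SGroup (fun n => quot (verbal V (K n)))
  (fun n i => vmap (face i)) (fun n i => vmap (degen i))) => n.
- by move=> i j x ij; apply: vmap_eq2 => y; exact: face_face.
- by move=> i j x ij; apply: vmap_eq2 => y; exact: face_degen_lt.
- by move=> j x; apply: vmap_id2 => y; exact: face_degen_eq.
- by move=> j x; apply: vmap_id2 => y; exact: face_degen_eqS.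
- by move=> i j x ij; apply: vmap_eq2 => y; exact: face_degen_gt.
- by move=> i j x ij; apply: vmap_eq2 => y; exact: degen_degen.
Defined.

Definition squot_map (K L : sgroup) (f : shom K L) : shom (squot K) (squot L).
Proof.
exists (fun n => vmap (f n)) => n i; apply: vmap_eq2 => x.
- exact: smap_face.
- exact: smap_degen.
Defined.

Lemma squot_mapE (K L : sgroup) (f : shom K L) n (x : K n) :
  squot_map f n (proj _ x) = proj _ (f n x).
Proof. exact: vmapE. Qed.

End VQuotient.

(* Homotopy groups: pi_n(K) is the n-th homology group of the Moore complex,  *)
(* whose n-th term is the intersection of the kernels of d_0, ..., d_(n-1),   *)
(* with differential d_n.                                                     *)
Section Cycles.
Variable K : sgroup.

Definition cycles n : {pred K n} :=
  if n is m.+1 then fun x : K m.+1 => [forall i : 'I_m.+2, face i x == 1]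
  else predT.

Arguments cycles : clear implicits.

Lemma cycles0 (x : K 0) : x \in cycles 0.
Proof. by []. Qed.

Lemma cyclesSP n (x : K n.+1) :
  reflect (forall i : 'I_n.+2, face i x = 1) (x \in cycles n.+1).
Proof. by apply: (iffP forallP) => h i; apply/eqP; exact: h. Qed.

Fact cyclesM n : mulg_closed (cycles n).
Proof.
case: n => [//|n] x y /cyclesSP hx /cyclesSP hy; apply/cyclesSP => i.
by rewrite homM hx hy mulg1.
Qed.
Fact cycles1 n : 1 \in cycles n.
Proof. by case: n => [//|n]; apply/cyclesSP => i; rewrite hom1. Qed.
Fact cyclesV n : invg_closed (cycles n).
Proof.
case: n => [//|n] x /cyclesSP hx; apply/cyclesSP => i.
by rewrite homV hx invg1.
Qed.

HB.instance Definition _ n := isMulClosed.Build (K n) (cycles n) (@cyclesM n).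
HB.instance Definition _ n := isMul1Closed.Build (K n) (cycles n) (cycles1 n).
HB.instance Definition _ n := isInvClosed.Build (K n) (cycles n) (@cyclesV n).

Definition boundaries n : {pred K n} := fun x =>
  `[< exists2 y : K n.+1, (forall i : 'I_n.+1, face (upr i) y = 1) &
        face ord_max y = x >].

Arguments boundaries : clear implicits.

Lemma boundariesP n (x : K n) :
  reflect (exists2 y : K n.+1, (forall i : 'I_n.+1, face (upr i) y = 1) &
             face ord_max y = x) (x \in boundaries n).
Proof. exact: asboolP. Qed.

Fact boundariesM n : mulg_closed (boundaries n).
Proof.
move=> _ _ /boundariesP[x hx <-] /boundariesP[y hy <-]; apply/boundariesP.
by exists (x * y) => [i|]; rewrite homM ?hx ?hy ?mulg1.
Qed.
Fact boundaries1 n : 1 \in boundaries n.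
Proof. by apply/boundariesP; exists 1 => [i|]; rewrite hom1. Qed.
Fact boundariesV n : invg_closed (boundaries n).
Proof.
move=> _ /boundariesP[x hx <-]; apply/boundariesP.
by exists x^-1 => [i|]; rewrite homV ?hx ?invg1.
Qed.
Fact boundariesJ n x y : x \in boundaries n -> x ^ y \in boundaries n.
Proof.
case/boundariesP=> z hz <-; apply/boundariesP.
exists (z ^ degen ord_max y) => [i|]; rewrite homJ ?hz ?conj1g//.
have -> : ord_max = suc ord_max :> 'I_n.+2 by apply: val_inj.
by rewrite face_degen_eqS.
Qed.

HB.instance Definition _ n :=
  isMulClosed.Build (K n) (boundaries n) (@boundariesM n).
HB.instance Definition _ n :=
  isMul1Closed.Build (K n) (boundaries n) (boundaries1 n).
HB.instance Definition _ n :=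
  isInvClosed.Build (K n) (boundaries n) (@boundariesV n).
HB.instance Definition _ n :=
  isConjClosed.Build (K n) (boundaries n) (@boundariesJ n).

Definition pi n : groupType := sect (cycles n) (boundaries n).

End Cycles.

Arguments cycles : clear implicits.
Arguments boundaries : clear implicits.

Section PiMap.
Variables (K L : sgroup) (f : shom K L) (n : nat).

Fact smap_cycles (x : K n) : x \in cycles K n -> f n x \in cycles L n.
Proof.
case: n x => [//|m] x /cyclesSP hx; apply/cyclesSP => i.
by rewrite -smap_face hx hom1.
Qed.

Fact smap_boundaries (x : K n) :
  x \in boundaries K n -> f n x \in boundaries L n.
Proof.
case/boundariesP=> y hy <-; apply/boundariesP; exists (f n.+1 y) => [i|].
- by rewrite -smap_face hy hom1.
- by rewrite smap_face.
Qed.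

Definition pi_map : {multiplicative pi K n -> pi L n} :=
  sect_map smap_cycles smap_boundaries.

End PiMap.

Arguments pi_map {K L} f n.

Definition free_sgroup (K : sgroup) : Prop :=
  exists X : forall n, K n -> Prop, (forall n, free_basis (X n)) /\
    forall n (i : 'I_n.+1) x, X n x -> X n.+1 (degen i x).

Record resolution (G : groupType) := Resolution {
  res :> sgroup;
  res_free : free_sgroup res;
  aug : {multiplicative pi res 0 -> G};
  aug_bij : bijective aug;
  res_acyclic : forall n (x : pi res n.+1), x = 1
}.

(* f : K -> L lies over h : G -> H on pi_0 *)
Definition over (G H : groupType) (h : {multiplicative G -> H})
  (K : resolution G) (L : resolution H) (f : shom K L) : Prop :=
  forall x, aug L (pi_map f 0 x) = h (aug K x).

(* For a commutative square of simplicial groups                              *)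
(*            a                                                               *)
(*        K -----> L                                                          *)
(*      b |        | d                                                        *)
(*        R -----> S                                                          *)
(*            c                                                               *)
(* ker_map is the morphism ker a -> ker c induced by b, and dker is its       *)
(* kernel.                                                                    *)
Section Square.
Variables (K L R S : sgroup).
Variables (a : shom K L) (b : shom K R) (c : shom R S) (d : shom L S).
Hypothesis comm : forall n x, c n (b n x) = d n (a n x).

Fact ker_map_subproof n x : c n (scomp b (sker_incl a) n x) = 1.
Proof. by rewrite /= comm (eqP (valP x)) hom1. Qed.

Definition ker_map : shom (sker a) (sker c) := sker_lift ker_map_subproof.

Definition dker : sgroup := sker ker_map.

Definition dker_incl1 : shom dker (sker a) := sker_incl ker_map.

Fact dker_incl2_subproof n x :
  b n (scomp (sker_incl a) dker_incl1 n x) = 1.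
Proof. exact: (congr1 val (eqP (valP x))). Qed.

Definition dker_incl2 : shom dker (sker b) := sker_lift dker_incl2_subproof.

End Square.

Section Triple.
Variables (V : laws) (G : groupType) (M N : normalClosed G).

Lemma squot_comm (K L R S : sgroup)
    (a : shom K L) (b : shom K R) (c : shom R S) (d : shom L S) :
  (forall n x, c n (b n x) = d n (a n x)) ->
  forall n x, squot_map V c n (squot_map V b n x) =
              squot_map V d n (squot_map V a n x).
Proof. by move=> h n; apply: vmap_eq2 => x; exact: h. Qed.

(* S resolves G / MN, identified with (G / M) / (MN / M) and with             *)
(* (G / N) / (MN / N): gamma resolves the pair (G / M, MN / M) and delta the  *)
(* pair (G / N, MN / N).                                                      *)
Record triple_resolution := TripleResolution {
  resK : resolution G;
  resL : resolution (quot N);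
  resR : resolution (quot M);
  resS : resolution (quot (prodn M N));
  alpha : shom resK resL;
  beta : shom resK resR;
  gamma : shom resR resS;
  delta : shom resL resS;
  square : forall n x, gamma n (beta n x) = delta n (alpha n x);
  alpha_over : over (proj N) alpha;
  beta_over : over (proj M) beta;
  gamma_over : over (quot_proj (@prodn_subl G M N)) gamma;
  delta_over : over (quot_proj (@prodn_subr G M N)) delta;
  alphaV_surj : ssurj (squot_map V alpha);
  betaV_surj : ssurj (squot_map V beta);
  gammaV_surj : ssurj (squot_map V gamma);
  deltaV_surj : ssurj (squot_map V delta);
  ker_alphaV_surj : ssurj (ker_map (squot_comm square));
  ker_betaV_surj : ssurj (ker_map (fun n x => esym (squot_comm square x)))
}.

Arguments alpha : clear implicits.
Arguments beta : clear implicits.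
Arguments gamma : clear implicits.
Arguments delta : clear implicits.

Variable T : triple_resolution.

Definition alphaV : shom (squot V (resK T)) (squot V (resL T)) :=
  squot_map V (alpha T).
Definition betaV : shom (squot V (resK T)) (squot V (resR T)) :=
  squot_map V (beta T).
Definition gammaV : shom (squot V (resR T)) (squot V (resS T)) :=
  squot_map V (gamma T).
Definition deltaV : shom (squot V (resL T)) (squot V (resS T)) :=
  squot_map V (delta T).

Definition squareV : forall n x, gammaV n (betaV n x) = deltaV n (alphaV n x) :=
  squot_comm (@square T).
Definition squareV' : forall n x, deltaV n (alphaV n x) = gammaV n (betaV n x) :=
  fun n x => esym (squareV x).

(* ker alpha_V -> ker gamma_V and ker beta_V -> ker delta_V *)
Definition ker_beta : shom (sker alphaV) (sker gammaV) := ker_map squareV.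
Definition ker_alpha : shom (sker betaV) (sker deltaV) := ker_map squareV'.

(* ker (alpha_V, gamma_V) with its inclusions in ker alpha_V and ker beta_V *)
Definition ker_alpha_gamma : sgroup := sker ker_beta.
Definition incl_alpha : shom ker_alpha_gamma (sker alphaV) :=
  dker_incl1 squareV.
Definition incl_beta : shom ker_alpha_gamma (sker betaV) :=
  dker_incl2 squareV.

Definition baer_triple : groupType := pi ker_alpha_gamma 1.

End Triple.

Arguments alpha {V G M N} t : rename.
Arguments beta {V G M N} t : rename.
Arguments gamma {V G M N} t : rename.
Arguments delta {V G M N} t : rename.
Arguments alphaV {V G M N} T.
Arguments betaV {V G M N} T.
Arguments gammaV {V G M N} T.
Arguments deltaV {V G M N} T.
Arguments ker_alpha {V G M N} T.
Arguments ker_beta {V G M N} T.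
Arguments incl_alpha {V G M N} T.
Arguments incl_beta {V G M N} T.
Arguments triple_resolution V {G} M N.

(* The Baer invariant VM(G, N) read off from a morphism f : K -> L of free    *)
(* simplicial resolutions of G and G / N. Below, f is one of alpha, beta,     *)
(* gamma, delta of a triple_resolution: f itself need not be surjective, only *)
(* f_V is, which includes the case of a surjective f.                         *)
Definition baer_pair (V : laws) (K L : sgroup) (f : shom K L) : groupType :=
  pi (sker (squot_map V f)) 1.

Section Tail.
Variables (V : laws) (G : groupType) (M N : normalClosed G).

Fact tail1_sub x : x \in nvstar V N -> x \in prodn M (nvstar V N).
Proof. exact: prodn_subr. Qed.

Fact tail2_sub x : x \in nvstar V M -> x \in prodn N (nvstar V M).
Proof. exact: prodn_subr. Qed.

(* the natural map N / [N V* G] -> MN / M[N V* G] *)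
Definition tail1 :
    {multiplicative sect N (nvstar V N) ->
                    sect (prodn M N) (prodn M (nvstar V N))} :=
  @sect_map G G N (prodn M N) (nvstar V N) (prodn M (nvstar V N)) (idhom G)
    (@prodn_subr G M N) tail1_sub.

(* the natural map M / [M V* G] -> MN / N[M V* G] *)
Definition tail2 :
    {multiplicative sect M (nvstar V M) ->
                    sect (prodn M N) (prodn N (nvstar V M))} :=
  @sect_map G G M (prodn M N) (nvstar V M) (prodn N (nvstar V M)) (idhom G)
    (@prodn_subl G M N) tail2_sub.

End Tail.

Arguments tail1 V {G} M N.
Arguments tail2 V {G} M N.

(* Main.v *)
From HB Require Import structures.
From mathcomp Require Import all_boot.
From mathcomp Require Import boolp.
Require Import Defs.

(** Both sequences are the long exact homotopy sequence of a short exact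
sequence of simplicial groups, with the groups pi_0 at its right end computed
by hand. By hypothesis ker(alpha_V, gamma_V) -> ker alpha_V -> ker gamma_V is
short exact in every degree, and a surjection of simplicial groups lifts
normalised elements (those killed by all faces but the last) to normalised
elements (lift_normalised), which is what the usual diagram chase on Moore
complexes needs (pi_exact, connecting_exact). This gives exactness everywhere
up to pi_0(ker gamma_V); exchanging M and N gives the other sequence.

It remains to replace pi_0(ker alpha_V) -> pi_0(ker gamma_V) by
N/[NV*G] -> MN/M[NV*G]. The source is the case h : G -> G/N of the following:
if f : K -> L is a map of free resolutions over a surjection h : G -> H with
kernel N, and f_V is surjective, then pi_0(ker f_V) is N/[NV*G] (pi0_kernel).
An element of degree 0 of ker f_V is represented by k in K_0 with f(k) in
V(L_0). Choose a lift sigma : L_0 -> G of L_0 -> H, and send k to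
aug(k) sigma(f(k))^-1, which lies in N. All verifications on this formula rest
on one principle (verbal_congr): two homomorphisms into G that agree modulo N
agree on verbal subgroups modulo [NV*G]. It makes the class of the image
independent of the choices of k in its class in pi_0 and of sigma, and
multiplicative, since N and V(G) commute modulo [NV*G].

Bijectivity needs care because f_V, but not f, is surjective. The remedy is to
work modulo the subgroup of L_0 formed by the last faces d_1(v) of normalised
v in V(L_1): it lies in V(L_0) and maps to 1 in H, and f is surjective modulo
this subgroup, even with a prescribed image in G (lift_mod_vboundaries). So
freeness of L_0 gives a section tau of f modulo it, and sigma is taken to be
aug o tau. Surjectivity follows by lifting n in N over 1 in L_0. For
injectivity, an element of [NV*G] lifts to a verbal element of K_0 that is
trivial in L_0 modulo the subgroup (nvstar_lift); after correction by it and by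
the verbal element tau(f(k)), k becomes a last face d_1(k_1), and pi_1(L) = 0
allows k_1 to be changed so that f(k_1) is in V(L_1).

For gamma the same result, applied to G/M -> G/MN, computes pi_0(ker gamma_V),
and the preimage in G of [(MN/M) V* (G/M)] is M[NV*G] (nvstar_quot). The two
identifications are compatible because the two lifts L_0 -> G/M obtained from
alpha and from gamma agree modulo MN/M, so verbal_congr applies once more. *)

Set Implicit Arguments.
Unset Strict Implicit.
Unset Printing Implicit Defensive.

Local Open Scope group_scope.

(** * Subquotients of groups *)

Lemma proj_eq1 (G : groupType) (N : normalClosed G) x :
  proj N x = 1 <-> x \in N.
Proof.
by rewrite -(hom1 (proj N)); split=> [/esym/proj_eq|xN]; last
  (apply/esym/proj_eq; move: xN); rewrite invg1 mul1g.
Qed.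

(** A homomorphism out of a quotient that is described by choosing
representatives is obtained from the relation between an element and its
possible images; in groups, single-valuedness has to be checked only over 1. *)
Lemma hom_of_rel (A C : groupType) (R : A -> C -> Prop) :
    (forall a, exists c, R a c) ->
    (forall a c a' c', R a c -> R a' c' -> R (a * a') (c * c')) ->
    (forall c, R 1 c -> c = 1) ->
  exists phi : {multiplicative A -> C}, forall a c, R a c <-> phi a = c.
Proof.
move=> tot RM R1.
have fct a c c' : R a c -> R a c' -> c = c'.
  have [b Rb] := tot a^-1; move=> ac ac'.
  have cb1 d : R a d -> d * b = 1.
    by move=> ad; apply: R1; have := RM _ _ _ _ ad Rb; rewrite mulgV.
  by apply: (mulIg b); rewrite (cb1 _ ac) (cb1 _ ac').
have [phi phiP] := choice tot.
have phiM : {morph phi : x y / x * y}.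
  by move=> x y; apply: fct (phiP _) (RM _ _ _ _ _ _); exact: phiP.
exists (mkhom phiM) => a c; split=> [|<-]; last exact: phiP.
by move=> Rac; apply: fct (phiP a) Rac.
Qed.

Section SectionQuotient.
Variables (G : groupType) (H : groupClosed G) (N : normalClosed G).

Definition sclass x (xH : x \in H) : sect H N := proj _ (mksubg xH).

Lemma sclass_ind (u : sect H N) : exists x (xH : x \in H), u = sclass xH.
Proof. by have [[x xH] <-] := proj_surj u; exists x, xH. Qed.

Lemma sclass_eq x y (xH : x \in H) (yH : y \in H) :
  sclass xH = sclass yH <-> x^-1 * y \in N.
Proof. exact: proj_eq. Qed.

Lemma sclass_eq1 x (xH : x \in H) : sclass xH = 1 <-> x \in N.
Proof. exact: proj_eq1. Qed.

Lemma eq_sclass x y (xH : x \in H) (yH : y \in H) :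
  x = y -> sclass xH = sclass yH.
Proof. by move=> xy; apply/sclass_eq; rewrite xy mulVg gpred1. Qed.

Lemma sclassM x y (xH : x \in H) (yH : y \in H) (xyH : x * y \in H) :
  sclass xH * sclass yH = sclass xyH.
Proof. by rewrite /sclass -homM; congr (proj _ _); apply: val_inj. Qed.

End SectionQuotient.

Arguments sclass {G H} N {x} xH.

Lemma sect_mapE (G G' : groupType) (H : groupClosed G) (H' : groupClosed G')
    (N : normalClosed G) (N' : normalClosed G') (f : {multiplicative G -> G'})
    (fH : forall x, x \in H -> f x \in H')
    (fN : forall x, x \in N -> f x \in N')
    x (xH : x \in H) :
  sect_map fH fN (sclass N xH) = sclass N' (fH x xH).
Proof.
apply: etrans (quot_mapE (sect_map_sub fH fN) (mksubg xH)) _.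
by congr (proj _ _); apply: val_inj.
Qed.

(** * Verbal subgroups and congruences *)

Section GenInd.
Variables (G : groupType) (A P : G -> Prop).
Hypotheses (P1 : P 1) (PM : forall x y, P x -> P y -> P (x * y)).
Hypotheses (PV : forall x, P x -> P x^-1) (PA : forall x, A x -> P x).

Lemma gen_ind x : x \in gen A -> P x.
Proof.
pose S : {pred G} := fun x => `[< P x >].
have SM : mulg_closed S by move=> a b /asboolP Pa /asboolP Pb; exact/asboolP/PM.
have S1 : 1 \in S by exact/asboolP.
have SV : invg_closed S by move=> a /asboolP Pa; exact/asboolP/PV.
pose S' : groupClosed G := HB.pack_for (groupClosed G) S
  (isMulClosed.Build G S SM) (isMul1Closed.Build G S S1)
  (isInvClosed.Build G S SV).
by move=> /genP/(_ S') xA; apply/asboolP/xA => a /PA Pa; exact/asboolP.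
Qed.

End GenInd.

(** [NV*G] is generated by the effect of multiplying one variable of a law by
an element of N, so the values of f and g on a law agree modulo [NV*G]:
replace the values of the variables under f by those under g one by one. *)
Lemma verbal_congr V (A G : groupType) (N : normalClosed G)
    (f g : {multiplicative A -> G}) :
  (forall x, proj N (f x) = proj N (g x)) ->
  forall w, w \in verbal V A ->
    proj (nvstar V N) (f w) = proj (nvstar V N) (g w).
Proof.
move=> fg; apply: gen_ind => [|x y ex ey|x ex|_ [r [v [t [Vv ->]]]]].
- by rewrite !hom1.
- by rewrite !homM ex ey.
- by rewrite !homV ex.
rewrite (eval_hom f) (eval_hom g).
(* mix k is the hybrid assignment that has passed to g on the variables of
   index below k. *)
pose mix k (j : 'I_r) := if (j < k)%N then g (t j) else f (t j).
have mixP k : (k <= r)%N ->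
    proj (nvstar V N) (eval v (f \o t)) = proj (nvstar V N) (eval v (mix k)).
  elim: k => [_|k IHk kr]; first by congr (proj _ _); exact: eq_eval.
  rewrite (IHk (ltnW kr)); set i := Ordinal kr; set n := (f (t i))^-1 * g (t i).
  have -> : eval v (mix k.+1) =
      eval v (fun j => if j == i then mix k j * n else mix k j).
    apply: eq_eval => j; rewrite /mix ltnS leq_eqVlt -[j == i]/(val j == k).
    case: eqP => //= jk; have -> : j = i by apply: val_inj.
    by rewrite ltnn /n mulVKg.
  apply: (mulIg (proj (nvstar V N) (eval v (mix k)))^-1).
  rewrite mulgV -homV -homM; apply/esym/proj_eq1/gen_mem.
  by exists r, v, i, (mix k), n; split=> //; exact/proj_eq/fg.
apply: etrans (mixP r (leqnn r)) _; congr (proj _ _); apply: eq_eval => j.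
by rewrite /mix ltn_ord.
Qed.

(** Conjugation by n in N agrees with the identity modulo N, so verbal_congr
compares w with w ^ n. *)
Lemma verbal_commute V (G : groupType) (N : normalClosed G) n w :
  n \in N -> w \in verbal V G ->
  commute (proj (nvstar V N) n) (proj (nvstar V N) w).
Proof.
move=> nN wV; set p := proj _.
have pw : p w = p (w ^ n).
  apply: (@verbal_congr V G G N (idhom G) (conjhom n)) => // x.
  apply/proj_eq; have -> : x^-1 * conjhom n x = (n^-1 ^ x) * n.
    by rewrite /= /conjg !mulgA.
  by rewrite gpredM// gpredJg// gpredV.
by rewrite /commute -[RHS](homM p) (conjgC w n) [RHS]homM -pw.
Qed.

Lemma nvstar_hom V (G H : groupType) (N : normalClosed G) (N' : normalClosed H)
    (f : {multiplicative G -> H}) :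
  (forall x, x \in N -> f x \in N') ->
  forall x, x \in nvstar V N -> f x \in nvstar V N'.
Proof.
move=> fN x; apply: gen_hom => _ [r [v [i [g [n [Vv nN ->]]]]]].
exists r, v, i, (f \o g), (f n); split=> //; first exact: fN.
rewrite homM homV !eval_hom; congr (_ * _); apply: eq_eval => j /=.
by case: ifP => // _; exact: homM.
Qed.

(** * Normalised elements *)

Section Moore.
Variable K : sgroup.

(** Membership in the n+1-st term of the Moore complex. *)
Definition normalised n (x : K n.+1) := forall i : 'I_n.+1, face (upr i) x = 1.

Lemma suc_max n : suc ord_max = ord_max :> 'I_n.+2.
Proof. exact: val_inj. Qed.

Lemma face_face_max n (x : K n.+2) (i : 'I_n.+2) :
  face i (face ord_max x) = face ord_max (face (upr i) x).
Proof. by rewrite -suc_max face_face// -ltnS. Qed.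

Lemma cycles_normalised n (x : K n.+1) :
  x \in cycles K n.+1 <-> normalised x /\ face ord_max x = 1.
Proof.
split=> [/cyclesSP hx|[hx xm]]; first by split=> [i|]; exact: hx.
apply/cyclesSP=> i; case: (unliftP ord_max i) => [j ->|-> //].
rewrite -[RHS](hx j); congr (face _ x); apply: val_inj => /=.
by rewrite /bump leqNgt ltn_ord.
Qed.

Lemma face_max_cycles n (x : K n.+1) :
  normalised x -> face ord_max x \in cycles K n.
Proof.
case: n x => [//|n] x hx; apply/cyclesSP => i.
by rewrite face_face_max hx hom1.
Qed.

Lemma boundaries_intro n (x : K n.+1) :
  normalised x -> face ord_max x \in boundaries K n.
Proof. by move=> hx; apply/boundariesP; exists x. Qed.

Lemma normalisedM n (x y : K n.+1) :
  normalised x -> normalised y -> normalised (x * y).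
Proof. by move=> hx hy i; rewrite homM hx hy mulg1. Qed.

Lemma normalisedV n (x : K n.+1) : normalised x -> normalised x^-1.
Proof. by move=> hx i; rewrite homV hx invg1. Qed.

Lemma normalised_face_max n (x : K n.+2) :
  normalised x -> normalised (face ord_max x).
Proof. by move=> hx i; rewrite face_face_max hx hom1. Qed.

Lemma face_max_max n (x : K n.+2) :
  normalised x -> face ord_max (face ord_max x) = 1.
Proof. by move=> hx; rewrite face_face_max hx hom1. Qed.

(** Multiplication by a degenerate element kills the i-th face and keeps the
faces of smaller index trivial; iterating from 0 upwards normalises. *)
Definition moore_step n (i : 'I_n.+1) (x : K n.+1) : K n.+1 :=
  x * (degen i (face (upr i) x))^-1.

Lemma moore_step_eq n (i : 'I_n.+1) (x : K n.+1) :
  face (upr i) (moore_step i x) = 1.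
Proof. by rewrite homM homV face_degen_eq mulgV. Qed.

Lemma moore_step_lt n (i j : 'I_n.+1) (x : K n.+1) :
  (j < i)%N -> face (upr j) x = 1 -> face (upr j) (moore_step i x) = 1.
Proof.
move=> ji xj; rewrite homM homV xj mul1g.
case: n i j x ji xj => [|n] i j x ji xj; first by rewrite !ord1 in ji.
have [i' def_i] : exists i', i = suc i'.
  by case: (unliftP ord0 i) ji => [i' ->|->//] _; exists i'.
have ji' : (j <= i')%N by move: ji; rewrite def_i.
rewrite def_i face_degen_lt//.
have -> : upr (suc i') = suc (upr i') by apply: val_inj.
by rewrite face_face// xj !hom1 invg1.
Qed.

End Moore.

Lemma shom_normalised (K L : sgroup) (f : shom K L) n (x : K n.+1) :
  normalised x -> normalised (f n.+1 x).
Proof. by move=> hx i; rewrite -smap_face hx hom1. Qed.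

(** An arbitrary preimage becomes normalised by the corrections moore_step; at
each stage f maps the correcting factor to 1, because y is normalised. *)
Lemma lift_normalised (K L : sgroup) (f : shom K L) n (y : L n.+1) :
    surj (f n.+1) -> normalised y ->
  exists2 x : K n.+1, normalised x & f n.+1 x = y.
Proof.
move=> fsurj hy.
suff lift_upto k : (k <= n.+1)%N -> exists x : K n.+1, f n.+1 x = y /\
    forall i : 'I_n.+1, (i < k)%N -> face (upr i) x = 1.
  by have [x [fx hx]] := lift_upto _ (leqnn _); exists x => // i; exact: hx.
elim: k => [_|k IHk kn].
  by have [x fx] := fsurj y; exists x.
have [x [fx hx]] := IHk (ltnW kn).
exists (moore_step (Ordinal kn) x); split=> [|i].
  by rewrite homM homV smap_degen smap_face fx hy hom1 invg1 mulg1.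
rewrite ltnS leq_eqVlt => /orP[/eqP ik|ik]; last exact: moore_step_lt (hx i ik).
have -> : i = Ordinal kn by apply: val_inj.
exact: moore_step_eq.
Qed.

(** * The long exact homotopy sequence *)

Section LongExact.
Variables (F E B : sgroup) (i : shom F E) (f : shom E B).
Hypothesis i_inj : forall n, injective (i n).
Hypothesis ker_im : forall n (x : E n), f n x = 1 <-> exists z, i n z = x.
Hypothesis f_surj : ssurj f.

Let fi1 n (z : F n) : f n (i n z) = 1.
Proof. by apply/ker_im; exists z. Qed.

Let i1 n (z : F n) : i n z = 1 -> z = 1.
Proof. by move=> iz; apply: i_inj; rewrite iz hom1. Qed.

Let normalised_incl n (z : F n.+1) : normalised (i n.+1 z) -> normalised z.
Proof. by move=> hz j; apply: i1; rewrite smap_face hz. Qed.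

Let incl_cycles n (z : F n) : i n z \in cycles E n -> z \in cycles F n.
Proof.
case: n z => [//|n] z /cyclesSP hz; apply/cyclesSP => j.
by apply: i1; rewrite smap_face hz.
Qed.

Let incl_boundaries n (z : F n) (e : E n.+1) :
  normalised e -> f n.+1 e = 1 -> face ord_max e = i n z ->
  z \in boundaries F n.
Proof.
move=> he /ker_im[t te] ez; apply/boundariesP.
rewrite -te in he ez; exists t; first exact: normalised_incl.
by apply: (@i_inj n); rewrite smap_face ez.
Qed.

Lemma pi_exact n : exact (pi_map i n) (pi_map f n).
Proof.
move=> u; split=> [|[z <-]]; last first.
  have [x [xc ->]] := sclass_ind z; rewrite !sect_mapE; apply/sclass_eq1.
  by rewrite fi1 gpred1.
have [x [xc ->]] := sclass_ind u.
rewrite sect_mapE => /sclass_eq1/boundariesP[b hb bx].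
have [e he eb] := lift_normalised (@f_surj n.+1) hb.
have /ker_im[z zE] : f n (x * (face ord_max e)^-1) = 1.
  by rewrite homM homV smap_face eb bx mulgV.
have zc : z \in cycles F n.
  by apply: incl_cycles; rewrite zE gpredM// gpredV face_max_cycles.
exists (sclass _ zc); rewrite sect_mapE; apply/sclass_eq.
rewrite zE invgM invgK -mulgA mulVg mulg1.
exact: boundaries_intro.
Qed.

(** The snake relation: lift a cycle of B to a normalised e in E; its last
face lies in the image of F and represents the connecting image. *)
Let bd_rel n (u : pi B n.+1) (w : pi F n) : Prop :=
  exists (e : E n.+1) (z : F n) (ec : f n.+1 e \in cycles B n.+1)
    (zc : z \in cycles F n),
    [/\ normalised e, face ord_max e = i n z,
        u = sclass _ ec & w = sclass _ zc].

Lemma connecting_exact :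
  exists bd : forall n, {multiplicative pi B n.+1 -> pi F n}, forall n,
    exact (pi_map f n.+1) (bd n) /\ exact (bd n) (pi_map i n).
Proof.
suff conn n : exists bd : {multiplicative pi B n.+1 -> pi F n},
    exact (pi_map f n.+1) bd /\ exact bd (pi_map i n).
  by exists (fun n => projT1 (cid (conn n))) => n; case: (cid (conn n)).
have tot (u : pi B n.+1) : exists w : pi F n, bd_rel u w.
  have [b [bc ->]] := sclass_ind u.
  have [hb bm] := (cycles_normalised b).1 bc.
  have [e he eb] := lift_normalised (@f_surj n.+1) hb; subst b.
  have /ker_im[z ze] : f n (face ord_max e) = 1 by rewrite smap_face.
  have zc : z \in cycles F n by apply: incl_cycles; rewrite ze face_max_cycles.
  by exists (sclass _ zc), e, z, bc, zc; split.
have relM u w u' w' : bd_rel u w -> bd_rel u' w' ->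
    @bd_rel n (u * u') (w * w').
  move=> [e [z [ec [zc [he ez -> ->]]]]] [e' [z' [ec' [zc' [he' ez' -> ->]]]]].
  have eec : f n.+1 (e * e') \in cycles B n.+1 by rewrite homM gpredM.
  exists (e * e'), (z * z'), eec, (gpredM _ _ zc zc'); split.
  - exact: normalisedM.
  - by rewrite !homM ez ez'.
  - apply/esym; rewrite /sclass -homM; congr (proj _ _); apply: val_inj => /=.
    by rewrite homM.
  - exact: sclassM.
have rel1 (w : pi F n) : bd_rel 1 w -> w = 1.
  case=> [e [z [ec [zc [he ez]]]]] /esym/sclass_eq1/boundariesP[b hb be] ->.
  (* Subtracting from e the last face of a lift of the bounding element b
     moves e into F, without changing its last face. *)
  have [e2 he2 e2b] := lift_normalised (@f_surj n.+2) hb; apply/sclass_eq1.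
  apply: (@incl_boundaries n z (e * (face ord_max e2)^-1)).
  - exact: normalisedM he (normalisedV (normalised_face_max he2)).
  - by rewrite homM homV smap_face e2b be mulgV.
  - by rewrite homM homV (face_max_max he2) invg1 mulg1.
have [bd bdP] := hom_of_rel tot relM rel1.
exists bd; split=> u; split.
- move=> /bdP[e [z [ec [zc [he ez ->]]]]] /esym/sclass_eq1/boundariesP[t ht tz].
  have xc : e * (i n.+1 t)^-1 \in cycles E n.+1.
    apply/cycles_normalised; split.
      exact: normalisedM he (normalisedV (shom_normalised i ht)).
    by rewrite homM homV -smap_face tz ez mulgV.
  exists (sclass _ xc); rewrite sect_mapE; apply/sclass_eq.
  by rewrite homM homV fi1 invg1 mulg1 mulVg gpred1.
- move=> [w <-]; have [x [xc ->]] := sclass_ind w; rewrite sect_mapE.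
  have [hx xm] := (cycles_normalised x).1 xc.
  apply/bdP; exists x, 1, (smap_cycles f xc), gpred1; split=> //.
    by rewrite xm hom1.
  by apply/esym/sclass_eq1; rewrite gpred1.
- have [z [zc ->]] := sclass_ind u.
  rewrite sect_mapE => /sclass_eq1/boundariesP[e he ez].
  have ec : f n.+1 e \in cycles B n.+1.
    apply/cycles_normalised; split; first exact: shom_normalised.
    by rewrite -smap_face ez fi1.
  by exists (sclass _ ec); apply/bdP; exists e, z, ec, zc; split.
- move=> [w /bdP[e [z [ec [zc [he ez _ ->]]]]]]; rewrite sect_mapE.
  by apply/sclass_eq1; rewrite -ez boundaries_intro.
Qed.

End LongExact.

(** * Simplicial groups modulo a verbal subgroup *)

Section VProjection.
Variable V : laws.

Definition sproj (K : sgroup) : shom K (squot V K).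
Proof.
by exists (fun n => proj (verbal V (K n))) => n i x; rewrite [RHS]vmapE.
Defined.

(** The composite K -> K_V -> L_V is surjective, so the normalised image of y
in L_V lifts to a normalised element of K itself, not only of K_V. *)
Lemma lift_normalised_mod (K L : sgroup) (f : shom K L) n (y : L n.+1) :
    ssurj (squot_map V f) -> normalised y ->
  exists2 x : K n.+1, normalised x & y^-1 * f n.+1 x \in verbal V (L n.+1).
Proof.
move=> fsurj hy.
have gsurj : surj (scomp (squot_map V f) (sproj K) n.+1).
  move=> z; have [x <-] := fsurj _ z; have [k <-] := proj_surj x.
  by exists k.
have [x hx xy] := lift_normalised gsurj (shom_normalised (sproj L) hy).
by exists x => //; apply/proj_eq/(etrans (esym xy)); exact: vmapE.
Qed.

Section VBoundaries.
Variable L : sgroup.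

(** The boundaries of degree 0 of the simplicial subgroup V(L) of L. Working
modulo them, rather than modulo V(L_0), keeps the image under the augmentation
under control. *)
Definition vboundaries : {pred L 0} := fun d =>
  `[< exists v : L 1%N, [/\ v \in verbal V (L 1%N), normalised v &
                          face ord_max v = d] >].

Lemma vboundariesP d :
  reflect (exists v : L 1%N, [/\ v \in verbal V (L 1%N), normalised v &
                          face ord_max v = d]) (d \in vboundaries).
Proof. exact: asboolP. Qed.

Fact vboundariesM : mulg_closed vboundaries.
Proof.
move=> _ _ /vboundariesP[v [vV hv <-]] /vboundariesP[w [wV hw <-]].
apply/vboundariesP; exists (v * w); split; last by rewrite homM.
- exact: gpredM.
- exact: normalisedM.
Qed.
Fact vboundaries1 : 1 \in vboundaries.
Proof.
apply/vboundariesP; exists 1; split; rewrite ?gpred1 ?hom1//.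
by move=> i; rewrite hom1.
Qed.
Fact vboundariesV : invg_closed vboundaries.
Proof.
move=> _ /vboundariesP[v [vV hv <-]]; apply/vboundariesP; exists v^-1.
by split; rewrite ?gpredV ?homV//; exact: normalisedV.
Qed.
Fact vboundariesJ x y : x \in vboundaries -> x ^ y \in vboundaries.
Proof.
case/vboundariesP=> v [vV hv <-]; apply/vboundariesP.
exists (v ^ degen ord_max y); split.
- exact: gpredJg.
- by move=> i; rewrite homJ hv conj1g.
- by rewrite homJ -[X in _ ^ face X _]suc_max face_degen_eqS.
Qed.

HB.instance Definition _ := isMulClosed.Build (L 0) vboundaries vboundariesM.
HB.instance Definition _ := isMul1Closed.Build (L 0) vboundaries vboundaries1.
HB.instance Definition _ := isInvClosed.Build (L 0) vboundaries vboundariesV.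
HB.instance Definition _ := isConjClosed.Build (L 0) vboundaries vboundariesJ.

Lemma vboundaries_verbal d : d \in vboundaries -> d \in verbal V (L 0).
Proof. by case/vboundariesP=> v [vV _ <-]; exact: verbal_hom. Qed.

End VBoundaries.

End VProjection.

Arguments vboundaries : clear implicits.

(** * Free simplicial resolutions in low degrees *)

Section Augmentation.
Variables (G : groupType) (K : resolution G).

(** The augmentation as a map on K_0 rather than on pi_0(K). *)
Definition aug0_fun (x : K 0) : G :=
  aug K (sclass (boundaries K 0) (cycles0 x)).

Fact aug0_morph : {morph aug0_fun : x y / x * y}.
Proof.
move=> x y; rewrite -homM; congr (aug K _).
by rewrite (sclassM _ _ _ (cycles0 (x * y))).
Qed.

Definition aug0 : {multiplicative K 0 -> G} := mkhom aug0_morph.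

Arguments aug0 : simpl never.

Lemma aug0_surj : surj aug0.
Proof.
move=> g; have [augV _ augK] := aug_bij K.
have [x [xc xg]] := sclass_ind (augV g); exists x.
by rewrite -[RHS]augK xg; congr (aug K _); exact: eq_sclass.
Qed.

Lemma aug0_eq1 x :
  aug0 x = 1 <-> exists2 y : K 1%N, normalised y & face ord_max y = x.
Proof.
have aug_inj := bij_inj (aug_bij K).
split=> [|[y hy <-]].
  by rewrite -[RHS](hom1 (aug K)) => /aug_inj/sclass_eq1/boundariesP.
rewrite -(hom1 (aug K)); congr (aug K _).
by apply/sclass_eq1; exact: boundaries_intro.
Qed.

(** The two faces of y differ by the last face of the normalisation of y. *)
Lemma aug0_face (y : K 1%N) : aug0 (face ord_max y) = aug0 (face (upr ord0) y).
Proof.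
have : aug0 (face ord_max (moore_step ord0 y)) = 1.
  apply/aug0_eq1; exists (moore_step ord0 y) => // i.
  by rewrite (ord1 i) moore_step_eq.
rewrite /moore_step homM homV -[X in face X (degen _ _)]suc_max.
have -> : ord0 = ord_max :> 'I_1 by apply: val_inj.
by rewrite face_degen_eqS homM homV => /(canRL (mulgVK _)); rewrite mul1g.
Qed.

Lemma res_cycle n (x : K n.+1) :
  x \in cycles K n.+1 -> exists2 y, normalised y & face ord_max y = x.
Proof.
by move=> xc; apply/boundariesP; apply/(sclass_eq1 _ xc)/res_acyclic.
Qed.

End Augmentation.

Arguments aug0 {G} K : simpl never.

Lemma aug0_over (G H : groupType) (h : {multiplicative G -> H})
    (K : resolution G) (L : resolution H) (f : shom K L) :
  over h f -> forall x, aug0 L (f 0 x) = h (aug0 K x).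
Proof.
by move=> fh x; rewrite /= -fh sect_mapE; congr (aug L _); exact: eq_sclass.
Qed.

Section KernelClass.
Variables (V : laws) (K L : sgroup) (f : shom K L).

Fact kclass_sub k :
  f 0 k \in verbal V (L 0) ->
  proj (verbal V (K 0)) k \in kerg (squot_map V f 0).
Proof. by move=> fk; rewrite kergE squot_mapE; apply/eqP/proj_eq1. Qed.

Definition kclass k (fk : f 0 k \in verbal V (L 0)) :
    pi (sker (squot_map V f)) 0 :=
  sclass (boundaries (sker (squot_map V f)) 0)
    (cycles0 (K := sker (squot_map V f)) (mksubg (kclass_sub fk))).

Lemma kclass_ind u : exists k (fk : f 0 k \in verbal V (L 0)), u = kclass fk.
Proof.
have [[x xk] [xc ->]] := sclass_ind u; have [k kx] := proj_surj x; subst x.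
have fk : f 0 k \in verbal V (L 0).
  by apply/proj_eq1; rewrite -squot_mapE; apply/eqP.
by exists k, fk; apply/eq_sclass/val_inj.
Qed.

Lemma kclassM k k' fk fk' (fkk' : f 0 (k * k') \in verbal V (L 0)) :
  @kclass k fk * @kclass k' fk' = kclass fkk'.
Proof.
rewrite /kclass (sclassM _ _ _ (cycles0 (_ * _))); apply: eq_sclass.
by apply: val_inj; rewrite /= -[RHS]/(proj _ _) homM.
Qed.

Lemma kclass_eq1 k fk : @kclass k fk = 1 <-> exists y : K 1%N,
  [/\ f 1%N y \in verbal V (L 1%N),
      forall i : 'I_1, face (upr i) y \in verbal V (K 0) &
      k^-1 * face ord_max y \in verbal V (K 0)].
Proof.
split=> [/sclass_eq1/boundariesP[[Y Yk] hY /(congr1 val) /= Yx]|[y [fy hy ky]]].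
  have [y yY] := proj_surj Y; subst Y; exists y; split.
  - by apply/proj_eq1; rewrite -squot_mapE; apply/eqP.
  - move=> i; apply/proj_eq1; have /(congr1 val) /= <- := hY i.
    exact/esym/vmapE.
  - apply/proj_eq; rewrite -[LHS]/(proj_fun _ k) -Yx; exact: vmapE.
apply/sclass_eq1/boundariesP.
have yk : proj (verbal V (K 1%N)) y \in kerg (squot_map V f 1%N).
  by rewrite kergE squot_mapE; apply/eqP/proj_eq1.
exists (mksubg yk) => [i|]; apply: val_inj.
  by rewrite /= [LHS]vmapE; apply/proj_eq1.
by rewrite /= [LHS]vmapE; apply/esym/proj_eq.
Qed.

End KernelClass.

(** * Connected components of the kernel: the group N/[NV*G] *)

Section PiZeroKernel.
Variables (V : laws) (G H : groupType) (N : normalClosed G).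
Variables (h : {multiplicative G -> H}).
Variables (K : resolution G) (L : resolution H) (f : shom K L).
Hypothesis ker_h : forall x, x \in N <-> h x = 1.
Hypothesis h_surj : surj h.
Hypothesis f_over : over h f.
Hypothesis fV_surj : ssurj (squot_map V f).

Notation star := (proj (nvstar V N)).
Notation dV := (vboundaries V L).

Lemma ker_proj_eq x y : h x = h y -> proj N x = proj N y.
Proof. by move=> hxy; apply/proj_eq/ker_h; rewrite homM homV hxy mulVg. Qed.

Lemma aug0_vboundaries d : d \in dV -> aug0 L d = 1.
Proof. by case/vboundariesP=> v [_ hv <-]; rewrite aug0_face hv hom1. Qed.

(** A preimage k0 of g has f(k0) = l up to the last face of a normalised y;
lifting y modulo V(L_1) and correcting k0 by the last face of the lift leaves
only the boundary of a verbal element. *)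
Lemma lift_mod_vboundaries l g : h g = aug0 L l ->
  exists2 k, aug0 K k = g & l^-1 * f 0 k \in dV.
Proof.
move=> hg; have [k0 k0g] := aug0_surj K g.
have [y hy yl] : exists2 y : L 1%N, normalised y &
    face ord_max y = (f 0 k0)^-1 * l.
  by apply/aug0_eq1; rewrite homM homV (aug0_over f_over) k0g hg mulVg.
have [x hx xy] := lift_normalised_mod fV_surj hy.
exists (k0 * face ord_max x).
  by rewrite homM k0g (_ : aug0 K (face _ _) = 1) ?mulg1// aug0_face hx hom1.
apply/vboundariesP; exists (y^-1 * f 1%N x); split=> //.
  exact: normalisedM (normalisedV hy) (shom_normalised f hx).
by rewrite !homM homV yl invgM invgK smap_face mulgA.
Qed.

Lemma section_mod_vboundaries :
  exists tau : {multiplicative L 0 -> K 0}, forall l, l^-1 * f 0 (tau l) \in dV.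
Proof.
have [X [X_basis _]] := res_free L.
have /choice[t tP] : forall l, exists k, l^-1 * f 0 k \in dV.
  move=> l; have [g hg] := h_surj (aug0 L l).
  by have [k _ lk] := lift_mod_vboundaries hg; exists k.
have [tau tauX _] := X_basis 0 _ t.
have [phi _ phi_uniq] := X_basis 0 _ (proj dV).
(* Both homomorphisms to the quotient by dV agree on the basis X. *)
exists tau => l; apply/proj_eq.
rewrite -[LHS]/(proj dV l) -[RHS]/((proj dV \o (f 0 \o tau)) l).
rewrite (phi_uniq (proj dV))// phi_uniq// => x Xx /=; rewrite tauX//.
by apply/esym/proj_eq.
Qed.

(** In a generator v(.., g_i n, ..) v(g)^-1, lift the g_j arbitrarily and n
over 1 in L_0: the two values of v then have the same image in L_0 modulo the
boundaries of V(L). *)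
Lemma nvstar_lift q : q \in nvstar V N ->
  exists w, [/\ w \in verbal V (K 0), aug0 K w = q & f 0 w \in dV].
Proof.
move: q.
apply: gen_ind => [|_ _ [w [wV <- wD]] [w' [wV' <- wD']]|_ [w [wV <- wD]]|].
- by exists 1; rewrite !hom1 !gpred1.
- by exists (w * w'); rewrite !homM !gpredM.
- by exists w^-1; rewrite !homV !gpredV.
move=> _ [r [v [i [g [n [Vv /ker_h hn ->]]]]]].
have /choice[k kg] : forall j, exists k, aug0 K k = g j.
  by move=> j; exact: aug0_surj.
have [x xn xD] : exists2 x, aug0 K x = n & f 0 x \in dV.
  have [|x xn xD] := @lift_mod_vboundaries 1 n; first by rewrite hn hom1.
  by exists x; move: xD; rewrite // invg1 mul1g.
pose kx j := if j == i then k j * x else k j.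
exists (eval v kx * (eval v k)^-1); split.
- by rewrite gpredM ?gpredV//; apply: gen_mem; exists r, v; eexists; split.
- rewrite homM homV !eval_hom.
  congr (_ * _^-1); apply: eq_eval => j; rewrite /comp ?kg// /kx.
  by case: ifP => _; rewrite ?homM kg ?xn.
apply/proj_eq1; rewrite !homM !homV !eval_hom.
apply: (canLR (mulgK _)); rewrite mul1g.
apply: eq_eval => j; rewrite /comp /kx; case: ifP => // _.
by rewrite !homM ((proj_eq1 _ _).2 xD) mulg1.
Qed.

Section Comparison.
Variable sigma : {multiplicative L 0 -> G}.
Hypothesis sigma_over : forall l, h (sigma l) = aug0 L l.

Lemma star_verbal w :
  w \in verbal V (K 0) -> star (aug0 K w) = star (sigma (f 0 w)).
Proof.
apply: (@verbal_congr V _ _ N (aug0 K) (sigma \o f 0)) => x.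
by apply: ker_proj_eq; rewrite -(aug0_over f_over) /= sigma_over.
Qed.

Lemma star_face v : v \in verbal V (L 1%N) ->
  star (sigma (face ord_max v)) = star (sigma (face (upr ord0) v)).
Proof.
apply: (@verbal_congr V _ _ N (sigma \o face ord_max)
  (sigma \o face (upr ord0))) => x.
by apply: ker_proj_eq; rewrite /= !sigma_over aug0_face.
Qed.

(** The formula aug(k) sigma(f(k))^-1 is trivial on boundaries: up to a verbal
element k is the last face of some y whose other face is verbal; the
augmentation identifies the two faces of y, and sigma identifies those of the
verbal element f(y) modulo [NV*G]. *)
Lemma star_boundary k (fk : f 0 k \in verbal V (L 0)) :
  kclass fk = 1 -> star (aug0 K k) = star (sigma (f 0 k)).
Proof.
case/kclass_eq1=> y [fyV yV kyV].
have ky : k = face ord_max y * (k^-1 * face ord_max y)^-1.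
  by rewrite invgM invgK mulVKg.
have wV : (k^-1 * face ord_max y)^-1 \in verbal V (K 0) by rewrite gpredV.
rewrite ky !homM (star_verbal wV); congr (_ * _).
by rewrite aug0_face star_verbal// !smap_face star_face.
Qed.

Lemma star_diff k : aug0 K k * (sigma (f 0 k))^-1 \in N.
Proof.
apply/ker_h; rewrite homM homV sigma_over (aug0_over f_over).
by rewrite mulgV.
Qed.

Let theta_rel (u : pi (sker (squot_map V f)) 0) (s : sect N (nvstar V N)) :=
  exists k (fk : f 0 k \in verbal V (L 0)) n (nN : n \in N),
    [/\ u = kclass fk, s = sclass (nvstar V N) nN &
        star n = star (aug0 K k * (sigma (f 0 k))^-1)].

Lemma theta_exists : exists theta :
    {multiplicative pi (sker (squot_map V f)) 0 -> sect N (nvstar V N)},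
  forall u s, theta_rel u s <-> theta u = s.
Proof.
apply: hom_of_rel => [u|a s a' s' [k [fk [n [nN [-> -> kn]]]]]|s].
- have [k [fk ->]] := kclass_ind u.
  by exists (sclass _ (star_diff k)), k, fk, _, (star_diff k).
- move=> [k' [fk' [n' [nN' [-> -> kn']]]]].
  have fkk' : f 0 (k * k') \in verbal V (L 0) by rewrite homM gpredM.
  exists (k * k'), fkk', (n * n'), (gpredM _ _ nN nN'); split.
  - exact: kclassM.
  - exact: sclassM.
  have /(@verbal_commute V _ _ _ _ nN') : (sigma (f 0 k))^-1 \in verbal V G.
    by rewrite gpredV; exact: verbal_hom.
  rewrite /commute [star (n * n')]homM kn kn' !homM invgM !homM => comm.
  by rewrite -mulgA -comm !mulgA.
- move=> [k [fk [n [nN [/esym k1 -> kn]]]]].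
  apply/sclass_eq1/proj_eq1/(etrans kn).
  by rewrite homM homV (star_boundary k1) mulgV.
Qed.

End Comparison.

(** theta is an isomorphism; the lift sigma is exposed so that the isomorphisms
of two resolutions can be compared. *)
Lemma pi0_kernel : exists (sigma : {multiplicative L 0 -> G})
    (theta : {multiplicative pi (sker (squot_map V f)) 0 ->
                             sect N (nvstar V N)}),
  [/\ forall l, h (sigma l) = aug0 L l,
      forall u, theta u = 1 -> u = 1, surj theta &
      forall k (fk : f 0 k \in verbal V (L 0)) n (nN : n \in N),
        star n = star (aug0 K k * (sigma (f 0 k))^-1) ->
        theta (kclass fk) = sclass (nvstar V N) nN].
Proof.
have [tau tauP] := section_mod_vboundaries.
pose sigma : {multiplicative L 0 -> G} := aug0 K \o tau.
have sigma_over l : h (sigma l) = aug0 L l.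
  rewrite -[LHS]/(h (aug0 K (tau l))) -(aug0_over f_over).
  apply: (mulgI (aug0 L l)^-1).
  by rewrite -homV -homM aug0_vboundaries// homV mulVg.
have [theta thetaP] := theta_exists sigma_over.
exists sigma, theta; split=> //.
- move=> u /thetaP[k [fk [n [nN [-> /esym/sclass_eq1 nstar]]]]].
  move=> /esym; rewrite ((proj_eq1 _ _).2 nstar) => /proj_eq1.
  (* w and t are verbal, so w^-1 k t^-1 represents the class of k times a
     verbal element; it maps to 1 in G, hence is a last face of some k1. *)
  set t := tau (f 0 k); rewrite -[sigma _]/(aug0 K t) -homV -homM => qstar.
  have tV : t \in verbal V (K 0) by exact: verbal_hom.
  have ktD : f 0 (k * t^-1) \in dV.
    apply/proj_eq1; rewrite !homM !homV.
    have <- : proj dV (f 0 k) = proj dV (f 0 t) by exact/proj_eq/tauP.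
    by rewrite mulgV.
  have [w [wV wq wD]] := nvstar_lift qstar.
  have [k1 hk1 k1E] : exists2 k1 : K 1%N, normalised k1 &
      face ord_max k1 = w^-1 * (k * t^-1).
    by apply/aug0_eq1; rewrite homM homV wq mulVg.
  have /vboundariesP[v [vV hv vE]] : f 0 (face ord_max k1) \in dV.
    by rewrite k1E homM homV gpredM// gpredV.
  (* f(k1) and the verbal v have the same last face, so f(k1) v^-1 is a cycle
     and bounds y; the last face of a lift z of y brings f(k1) into V(L_1). *)
  have [y hy yE] : exists2 y : L 2, normalised y &
      face ord_max y = f 1%N k1 * v^-1.
    apply: res_cycle; apply/cycles_normalised; split.
      exact: normalisedM (shom_normalised f hk1) (normalisedV hv).
    by rewrite homM homV vE smap_face mulgV.
  have [z hz zy] := lift_normalised_mod fV_surj hy.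
  apply/kclass_eq1; exists (k1 * (face ord_max z)^-1); split.
  - rewrite homM homV smap_face -(mulVKg y (f 2 z)).
    rewrite [face _ _]homM yE !invgM invgK.
    set b := (face ord_max _)^-1.
    have -> : f 1%N k1 * (b * (v * (f 1%N k1)^-1)) = (b * v) ^ (f 1%N k1)^-1.
      by rewrite /conjg invgK !mulgA.
    by rewrite gpredJg// gpredM// gpredV verbal_hom.
  - move=> i; rewrite homM homV hk1 (normalised_face_max hz).
    by rewrite invg1 mulg1 gpred1.
  - rewrite homM homV (face_max_max hz) invg1 mulg1 k1E.
    have -> : k^-1 * (w^-1 * (k * t^-1)) = w^-1 ^ k * t^-1.
      by rewrite /conjg !mulgA.
    by rewrite gpredM ?gpredJg ?gpredV.
- move=> s; have [n [nN ->]] := sclass_ind s.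
  have [|k kn kD] := @lift_mod_vboundaries 1 n.
    by rewrite hom1; exact/ker_h.
  rewrite invg1 mul1g in kD; have fk := vboundaries_verbal kD.
  exists (kclass fk); apply/thetaP; exists k, fk, n, nN; split=> //.
  rewrite homM homV kn; case/vboundariesP: kD => v [vV hv <-].
  by rewrite (star_face sigma_over vV) hv !hom1 invg1 mulg1.
- by move=> k fk n nN kn; apply/thetaP; exists k, fk, n, nN.
Qed.

End PiZeroKernel.

(** * The exact sequences of a triple *)

(** One of the two sequences. P is MN, kept abstract so that M and N can be
exchanged; F is the double kernel, given as a kernel of the map between the
kernels of a_V and c_V. The commutation proof squareV_comm is arbitrary since
ker_map depends on it. *)
Section HalfTriple.
Variables (V : laws) (G : groupType) (M N P : normalClosed G).
Hypothesis sMP : forall x, x \in M -> x \in P.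
Hypothesis sNP : forall x, x \in N -> x \in P.
Hypothesis P_prod : forall x, x \in P ->
  exists m n, [/\ m \in M, n \in N & x = m * n].
Hypothesis sMN : forall x, x \in nvstar V N -> x \in prodn M (nvstar V N).

Notation ker_quot_proj := (kerg (quot_proj sMP)).

Lemma ker_quot_projE x : (proj M x \in ker_quot_proj) = (x \in P).
Proof.
rewrite kergE [quot_proj _ _]quot_mapE; apply/eqP/idP; last by move/proj_eq1.
exact: (proj_eq1 P x).1.
Qed.

(** The generators of [(P/M) V* (G/M)] lift to generators of [NV*G], because
every element of P = MN is congruent modulo M to an element of N. *)
Lemma nvstar_quot x :
  (proj M x \in nvstar V ker_quot_proj) = (x \in prodn M (nvstar V N)).
Proof.
apply/idP/prodnP; last first.
  move=> [m [n [mM nN ->]]]; rewrite homM (proj_eq1 _ _).2// mul1g.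
  by apply: nvstar_hom nN => y /sNP; rewrite ker_quot_projE.
suff lift y : y \in nvstar V ker_quot_proj ->
    exists2 z, z \in nvstar V N & proj M z = y.
  case/lift=> z zN zx; exists (x * z^-1), z; split=> //; last by rewrite mulgVK.
  by apply/proj_eq1; rewrite homM homV zx mulgV.
move: y; apply: gen_ind => [|y y' [z zN zy] [z' zN' zy']|y [z zN zy]|].
- by exists 1; rewrite ?gpred1 ?hom1.
- by exists (z * z'); rewrite ?gpredM// homM zy zy'.
- by exists z^-1; rewrite ?gpredV// homV zy.
move=> y [r [v [i [g [n [Vv]]]]]].
have [n0 <-] := proj_surj n.
rewrite ker_quot_projE => /P_prod[m [n1 [mM nN ->]]] ->.
have /choice[t tg] : forall j, exists x, proj M x = g j.
  by move=> j; exact: proj_surj.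
exists (eval v (fun j => if j == i then t j * n1 else t j) * (eval v t)^-1).
  by apply: gen_mem; exists r, v, i, t, n1.
rewrite homM homV !eval_hom.
congr (_ * _^-1); apply: eq_eval => j; last exact: tg.
rewrite /comp; case: ifP => _; rewrite ?homM tg//; congr (_ * _).
by rewrite -[RHS]/(proj M (m * n1)) homM (proj_eq1 M m).2// mul1g.
Qed.

Definition tail_map :
    {multiplicative sect N (nvstar V N) -> sect P (prodn M (nvstar V N))} :=
  @sect_map G G N P (nvstar V N) (prodn M (nvstar V N)) (idhom G) sNP sMN.

Lemma tail_map_surj : surj tail_map.
Proof.
move=> y; have [x [xP ->]] := sclass_ind y.
have [m [n [mM nN xmn]]] := P_prod xP; exists (sclass _ nN); rewrite sect_mapE.
apply/sclass_eq/prodnP; exists (m ^ n), 1; rewrite gpred1 gpredJg//; split=> //.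
by rewrite mulg1 xmn.
Qed.

Variables (K : resolution G) (L : resolution (quot N)).
Variables (R : resolution (quot M)) (S : resolution (quot P)).
Variables (a : shom K L) (b : shom K R) (c : shom R S) (d : shom L S).
Hypothesis square_comm : forall n x, c n (b n x) = d n (a n x).
Hypothesis a_over : over (proj N) a.
Hypothesis b_over : over (proj M) b.
Hypothesis c_over : over (quot_proj sMP) c.
Hypothesis d_over : over (quot_proj sNP) d.
Hypothesis aV_surj : ssurj (squot_map V a).
Hypothesis cV_surj : ssurj (squot_map V c).
Hypothesis squareV_comm : forall n x,
  squot_map V c n (squot_map V b n x) = squot_map V d n (squot_map V a n x).

Variables (F : sgroup) (i : shom F (sker (squot_map V a))).
Hypothesis i_inj : forall n, injective (i n).
Hypothesis ker_im : forall n x,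
  ker_map squareV_comm n x = 1 <-> exists z, i n z = x.
Hypothesis ker_map_surj : ssurj (ker_map squareV_comm).

(** The isomorphisms theta for a and eta for c are compatible (starE below), so
the kernels correspond because eta is injective. *)
Lemma pi0_kernel_square :
  exists theta : {multiplicative pi (sker (squot_map V a)) 0 ->
                                 sect N (nvstar V N)},
  [/\ forall u, theta u = 1 -> u = 1, surj theta &
      forall u, tail_map (theta u) = 1 <->
                pi_map (ker_map squareV_comm) 0 u = 1].
Proof.
have kN x : x \in N <-> proj N x = 1 by rewrite proj_eq1.
have kP y : y \in ker_quot_proj <-> quot_proj sMP y = 1.
  by rewrite kergE; split=> /eqP.
have quot_proj_surj : surj (quot_proj sMP).
  by move=> y; have [x <-] := proj_surj y; exists (proj M x); exact: quot_mapE.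
have [sigma [theta [sigma_over theta_inj theta_surj thetaP]]] :=
  pi0_kernel kN (@proj_surj _ _) a_over aV_surj.
have [rho [eta [rho_over eta_inj _ etaP]]] :=
  pi0_kernel kP quot_proj_surj c_over cV_surj.
exists theta; split=> // u.
have [k [ak ->]] := kclass_ind u.
have nN := star_diff kN a_over sigma_over k; set n := _ * _ in nN.
rewrite (thetaP k ak n nN erefl) sect_mapE.
have cb : c 0 (b 0 k) \in verbal V (S 0) by rewrite square_comm verbal_hom.
have -> : pi_map (ker_map squareV_comm) 0 (kclass ak) = kclass cb.
  rewrite sect_mapE; apply: eq_sclass.
  by apply: val_inj; exact: vmapE.
have nP : proj M n \in ker_quot_proj by rewrite ker_quot_projE sNP.
(* The lifts proj M o sigma and rho o d of L_0 to G/M agree modulo P/M. *)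
have starE : proj (nvstar V ker_quot_proj) (proj M n) =
    proj (nvstar V ker_quot_proj) (aug0 R (b 0 k) * (rho (c 0 (b 0 k)))^-1).
  rewrite /n !homM !homV (aug0_over b_over) square_comm; congr (_ * _^-1).
  apply: (@verbal_congr V _ _ _ (proj M \o sigma) (rho \o d 0)) ak => l.
  apply: (ker_proj_eq kP); rewrite /comp.
  rewrite -[RHS]/(quot_proj sMP (rho (d 0 l))) rho_over.
  rewrite (aug0_over d_over) -sigma_over.
  rewrite -[LHS]/(quot_proj sMP (proj M (sigma l))).
  by rewrite [LHS]quot_mapE [RHS]quot_mapE.
have eta_tail : eta (kclass cb) = 1 <-> n \in prodn M (nvstar V N).
  by rewrite (etaP _ _ _ nP starE) sclass_eq1 nvstar_quot.
split=> [/sclass_eq1/eta_tail/eta_inj //|bk1].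
by apply/sclass_eq1/eta_tail; rewrite bk1 hom1.
Qed.

Lemma half_triple_exact :
  exists (bd : forall n,
        {multiplicative pi (sker (squot_map V c)) n.+1 -> pi F n})
      (e : {multiplicative pi F 0 -> sect N (nvstar V N)}),
    (forall n, [/\ exact (pi_map i n.+1) (pi_map (ker_map squareV_comm) n.+1),
       exact (pi_map (ker_map squareV_comm) n.+1) (bd n) &
       exact (bd n) (pi_map i n)]) /\
    [/\ exact (bd 0) e, exact e tail_map & surj tail_map].
Proof.
have [bd bdP] := connecting_exact i_inj ker_im ker_map_surj.
have i0_exact := pi_exact i_inj ker_im ker_map_surj (n := 0).
have [theta [theta_inj theta_surj thetaP]] := pi0_kernel_square.
exists bd, (theta \o pi_map i 0); split.
  move=> n; have [? ?] := bdP n; split=> //.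
  exact: pi_exact i_inj ker_im ker_map_surj _.
split; last exact: tail_map_surj.
- move=> w; rewrite -(bdP 0).2; split=> [/theta_inj //|iw].
  by rewrite -[LHS]/(theta (pi_map i 0 w)) iw hom1.
move=> s; have [u <-] := theta_surj s; rewrite thetaP i0_exact.
split=> -[w]; first by move=> <-; exists w.
move=> uw; exists w; apply: (mulIg u^-1); rewrite mulgV; apply: theta_inj.
by rewrite homM homV -uw mulgV.
Qed.

End HalfTriple.

(** The double kernel is by construction the kernel of ker a -> ker c; it is
isomorphic, but not identical, to the kernel of ker b -> ker d, which the
second sequence needs. *)
Section DoubleKernel.
Variables (K L R S : sgroup).
Variables (a : shom K L) (b : shom K R) (c : shom R S) (d : shom L S).
Hypothesis comm : forall n x, c n (b n x) = d n (a n x).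

Lemma dker_incl1_exact n x :
  ker_map comm n x = 1 <-> exists z, dker_incl1 comm n z = x.
Proof.
split=> [xk|[z <-]]; last exact/eqP/(valP z).
have xK : x \in kerg (ker_map comm n) by rewrite kergE xk.
by exists (mksubg xK).
Qed.

Lemma dker_incl1_inj n : injective (dker_incl1 comm n).
Proof. exact: val_inj. Qed.

Lemma dker_incl2_exact n x :
  ker_map (fun n x => esym (comm x)) n x = 1 <->
  exists z, dker_incl2 comm n z = x.
Proof.
split=> [/(congr1 val) /= xa|[z <-]]; last first.
  exact/val_inj/eqP/(valP (val z)).
have xA : val x \in kerg (a n) by rewrite kergE; apply/eqP.
have xK : mksubg xA \in kerg (ker_map comm n).
  by rewrite kergE; apply/eqP/val_inj/eqP/(valP x).
by exists (mksubg xK); apply: val_inj.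
Qed.

Lemma dker_incl2_inj n : injective (dker_incl2 comm n).
Proof. by move=> x y /(congr1 val) /= xy; do 2!apply: val_inj. Qed.

End DoubleKernel.

Theorem theorem3p2 (V : laws) (G : groupType) (M N : normalClosed G)
    (T : triple_resolution V M N) :
  (exists (bd : forall n, {multiplicative pi (sker (gammaV T)) n.+1 ->
                                          pi (ker_alpha_gamma T) n})
          (e : {multiplicative pi (ker_alpha_gamma T) 0 ->
                               sect N (nvstar V N)}),
    let i : {multiplicative baer_triple T -> baer_pair V (alpha T)} :=
      pi_map (incl_alpha T) 1 in
    let p : {multiplicative baer_pair V (alpha T) -> baer_pair V (gamma T)} :=
      pi_map (ker_beta T) 1 in
    (forall n, (0 < n)%N ->
      [/\ exact (pi_map (incl_alpha T) n.+1) (pi_map (ker_beta T) n.+1),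
          exact (pi_map (ker_beta T) n.+1) (bd n) &
          exact (bd n) (pi_map (incl_alpha T) n)]) /\
    [/\ exact i p, exact p (bd 0), exact (bd 0) e, exact e (tail1 V M N) &
        surj (tail1 V M N)]) /\
  (exists (bd : forall n, {multiplicative pi (sker (deltaV T)) n.+1 ->
                                          pi (ker_alpha_gamma T) n})
          (e : {multiplicative pi (ker_alpha_gamma T) 0 ->
                               sect M (nvstar V M)}),
    let i : {multiplicative baer_triple T -> baer_pair V (beta T)} :=
      pi_map (incl_beta T) 1 in
    let p : {multiplicative baer_pair V (beta T) -> baer_pair V (delta T)} :=
      pi_map (ker_alpha T) 1 in
    (forall n, (0 < n)%N ->
      [/\ exact (pi_map (incl_beta T) n.+1) (pi_map (ker_alpha T) n.+1),
          exact (pi_map (ker_alpha T) n.+1) (bd n) &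
          exact (bd n) (pi_map (incl_beta T) n)]) /\
    [/\ exact i p, exact p (bd 0), exact (bd 0) e, exact e (tail2 V M N) &
        surj (tail2 V M N)]).
Proof.
have prodC x : x \in prodn M N -> exists n m, [/\ n \in N, m \in M & x = n * m].
  case/prodnP=> m [n [mM nN ->]]; exists (n ^ m^-1), m.
  by split=> //; [exact: gpredJg | rewrite /conjg invgK mulgA mulgVK].
split.
- have [bd [e [les [bde etail tsurj]]]] := half_triple_exact
    (fun x => elimT (@prodnP G M N x)) (@tail1_sub V G M N)
    (@square _ _ _ _ T) (@alpha_over _ _ _ _ T) (@beta_over _ _ _ _ T)
    (@gamma_over _ _ _ _ T) (@delta_over _ _ _ _ T)
    (@alphaV_surj _ _ _ _ T) (@gammaV_surj _ _ _ _ T)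
    (dker_incl1_inj (comm := @squareV _ _ _ _ T))
    (dker_incl1_exact (@squareV _ _ _ _ T))
    (@ker_alphaV_surj _ _ _ _ T).
  by exists bd, e; split=> [n _|]; [exact: les | have [? ? ?] := les 0; split].
- have [bd [e [les [bde etail tsurj]]]] := half_triple_exact
    prodC (@tail2_sub V G M N)
    (fun n x => esym (@square _ _ _ _ T n x)) (@beta_over _ _ _ _ T)
    (@alpha_over _ _ _ _ T) (@delta_over _ _ _ _ T) (@gamma_over _ _ _ _ T)
    (@betaV_surj _ _ _ _ T) (@deltaV_surj _ _ _ _ T)
    (dker_incl2_inj (comm := @squareV _ _ _ _ T))
    (dker_incl2_exact (@squareV _ _ _ _ T))
    (@ker_betaV_surj _ _ _ _ T).
  by exists bd, e; split=> [n _|]; [exact: les | have [? ? ?] := les 0; split].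
Qed.
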